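(* The following are equivalent for a metric space $A$. (1) $A$ is stably positive definite (and thus every nonempty compact subset of $A$ has a defined, possibly infinite, magnitude). (2) $A$ is stably positive semidefinite. (3) There is a sequence $\{t_k > 0 : k\in\mathbb{N}\}$ with $\lim_{k\to\infty} t_k = 0$ such that $t_kA$ is positive semidefinite for every $k$. (4) $A$ is of negative type.
   Context: Metric spaces are nonempty. For a finite metric space $(B,d)$, its similarity matrix is $\zeta_B \in \mathbb{R}^{B\times B}$, $\zeta_B(x,y)=e^{-d(x,y)}$. A metric space $A$ is positive definite (respectively positive semidefinite) if $\zeta_B$ is a positive definite (respectively positive semidefinite) matrix for every nonempty finite subset $B \subseteq A$ with the induced metric. For $A=(A,d)$ and $t>0$, $tA$ denotes the metric space $(A,td)$; for $\alpha\in(0,1]$, $A^\alpha$ denotes $(A,d^\alpha)$. $A$ is stably positive definite (respectively stably positive semidefinite) if $tA$ is positive definite (respectively positive semidefinite) for every $t>0$. $A$ is of negative type if $A^{1/2}=(A,d^{1/2})$ is isometric to a subset of a Hilbert space. The magnitude of a compact positive definite metric space $(K,d)$ is defined as $|K| = \sup\{\mu(K)^2/Z_K(\mu,\mu) : \mu\in M(K),\ Z_K(\mu,\mu)\neq 0\}\in[1,\infty]$, where $M(K)$ is the space of finite signed Borel measures on $K$ and $Z_K(\mu,\nu)=\int_K\int_K e^{-d(x,y)}\,d\mu(x)\,d\nu(y)$. *)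

(* Defs.v *)
From HB Require Import structures.
From mathcomp Require Import all_boot all_order all_algebra.
From mathcomp Require Import finmap interval_inference.
From mathcomp Require Import all_classical all_reals all_analysis.

Set Implicit Arguments.
Unset Strict Implicit.
Unset Printing Implicit Defensive.

Import Order.TTheory GRing.Theory Num.Theory.
Import numFieldNormedType.Exports.

Local Open Scope classical_set_scope.
Local Open Scope ring_scope.

(* [scaled t A] is A with the distance t * d. *)
Definition scaled (R : realType) (t : {posnum R}) (A : Type) : Type := A.

Section scaled_metric.
Context {R : realType} (t : {posnum R}) (A : metricType R).

Let d (x y : scaled t A) : R := t%:num * mdist (x : A) (y : A).

Let d0 x : d x x = 0.
Proof. by rewrite /d mdistxx mulr0. Qed.

Let d_eq0 x y : d x y = 0 -> x = y.
Proof.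
by move=> /eqP; rewrite mulf_eq0 gt_eqF//= => /eqP /mdist_positivity.
Qed.

Let d_sym x y : d x y = d y x.
Proof. by rewrite /d metric_sym. Qed.

Let d_triangle y x z : d x z <= d x y + d y z.
Proof. by rewrite /d -mulrDr ler_pM2l// metric_triangle. Qed.

HB.instance Definition _ := Choice.copy (scaled t A) A.
HB.instance Definition _ := @isMetric.Build R (scaled t A) d d0 d_eq0 d_sym
  d_triangle.

End scaled_metric.

(* [snowflake a01 A] is A with the distance d ^ a, where a01 : 0 < a <= 1. *)
Definition snowflake (R : realType) (a : R) (a01 : 0 < a <= 1) (A : Type) :
  Type := A.

Lemma powR_subadditive (R : realType) (a x y : R) : 0 < a -> a <= 1 ->
  0 <= x -> 0 <= y -> (x + y) `^ a <= x `^ a + y `^ a.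
Proof.
move=> a0 a1 x0 y0; have := addr_ge0 x0 y0.
rewrite le_eqVlt => /predU1P[<-|s0].
  by rewrite powR0 ?gt_eqF// addr_ge0 ?powR_ge0.
have H z : 0 <= z -> z <= x + y -> z / (x + y) * (x + y) `^ a <= z `^ a.
  rewrite le_eqVlt => /predU1P[<- _|z0 zs]; first by rewrite !mul0r powR_ge0.
  have -> : z `^ a = (z / (x + y)) `^ a * (x + y) `^ a.
    by rewrite -powRM ?divrK ?unitfE ?gt_eqF ?divr_ge0 ?ltW.
  rewrite ler_wpM2r ?powR_ge0// ger1_powR//.
  by rewrite divr_gt0//= ler_pdivrMr ?mul1r.
have := lerD (H x x0 _) (H y y0 _).
by rewrite lerDl lerDr -!mulrDl divff ?gt_eqF// mul1r; apply.
Qed.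

Section snowflake_metric.
Context {R : realType} (a : R) (a01 : 0 < a <= 1) (A : metricType R).

Let d (x y : snowflake a01 A) : R := mdist (x : A) (y : A) `^ a.

Let a_gt0 : 0 < a. Proof. by case/andP: a01. Qed.

Let a_le1 : a <= 1. Proof. by case/andP: a01. Qed.

Let d0 x : d x x = 0.
Proof. by rewrite /d mdistxx powR0// gt_eqF. Qed.

Let d_eq0 x y : d x y = 0 -> x = y.
Proof. by move=> /powR_eq0_eq0 /mdist_positivity. Qed.

Let d_sym x y : d x y = d y x.
Proof. by rewrite /d metric_sym. Qed.

Let d_triangle y x z : d x z <= d x y + d y z.
Proof.
apply: le_trans (powR_subadditive a_gt0 a_le1 _ _); rewrite ?mdist_ge0//.
rewrite ge0_ler_powR ?nnegrE ?addr_ge0 ?mdist_ge0 ?metric_triangle//.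
exact: ltW.
Qed.

HB.instance Definition _ := Choice.copy (snowflake a01 A) A.
HB.instance Definition _ := @isMetric.Build R (snowflake a01 A) d d0 d_eq0 d_sym
  d_triangle.

End snowflake_metric.

Section induced_metric.
Context {R : realType} {A : metricType R} (K : set A).

Let d (x y : set_type K) : R := mdist (set_val x) (set_val y).

Let d_ge0 x y : 0 <= d x y.
Proof. exact: mdist_ge0. Qed.

Let d_eq0 x y : d x y = 0 -> x = y.
Proof. by move=> /mdist_positivity /val_inj. Qed.

Let ballE (x : set_type K) e : ball x e = [set y | d x y < e].
Proof.
rewrite /ball/= /initial_ball/=; apply/funext => y /=.
by rewrite ballEmdist.
Qed.

HB.instance Definition _ :=
  @PseudoMetric_isMetric.Build R (set_type K) d d_ge0 d_eq0 ballE.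

End induced_metric.

Section positive_definiteness.
Context {R : realType}.

Definition posdef_mx n (M : 'M[R]_n) : Prop :=
  M \is symmetricmx /\ forall v : 'rV_n, v != 0 -> 0 < (v *m M *m v^T) 0 0.

Definition possemidef_mx n (M : 'M[R]_n) : Prop :=
  M \is symmetricmx /\ forall v : 'rV_n, 0 <= (v *m M *m v^T) 0 0.

(* The rows and columns are indexed by B through [enum_val]. *)
Definition similarity_mx (A : metricType R) (B : {fset A}) : 'M[R]_#|{: B}| :=
  \matrix_(i, j) expR (- mdist (val (enum_val i)) (val (enum_val j))).

Definition positive_definite (A : metricType R) : Prop :=
  forall B : {fset A}, B != fset0 -> posdef_mx (similarity_mx B).

Definition positive_semidefinite (A : metricType R) : Prop :=
  forall B : {fset A}, B != fset0 -> possemidef_mx (similarity_mx B).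

Definition stably_positive_definite (A : metricType R) : Prop :=
  forall t : {posnum R}, positive_definite (scaled t A).

Definition stably_positive_semidefinite (A : metricType R) : Prop :=
  forall t : {posnum R}, positive_semidefinite (scaled t A).

Lemma half_itv01 : 0 < (2^-1 : R) <= 1.
Proof. by rewrite invr_gt0 ltr0n/= invf_le1 ?ler1n ?ltr0n. Qed.

(* A complete normed module is a (real) Hilbert space when its norm comes from
   an inner product. *)
Definition is_hilbert (H : completeNormedModType R) : Prop :=
  exists dot : {dot H for idfun}, forall u : H, `|u| ^+ 2 = dot u u.

Definition negative_type (A : metricType R) : Prop :=
  exists2 H : completeNormedModType R, is_hilbert H &
  exists f : snowflake half_itv01 A -> H,
    forall x y, `|f x - f y| = mdist x y.

End positive_definiteness.

Section magnitude.
Context {R : realType}.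

(* Integral against a signed measure through its Jordan decomposition; it does
   not depend on the chosen Hahn decomposition, by [Hahn_decomposition_uniq]. *)
Definition charge_integral d (T : measurableType d)
    (mu : {charge set T -> \bar R}) (f : T -> R) : R :=
  let exN := projT2 (cid (Hahn_decomposition mu)) in
  let muPN := projT2 (cid exN) in
  \int[jordan_pos muPN]_x f x - \int[jordan_neg muPN]_x f x.

(* Measurable types are pointed, so a nonempty space is pointed first, at an
   arbitrary point which plays no other role. *)
Definition pointed_by (K : metricType R) (K0 : [set: K] !=set0) : Type := K.

HB.instance Definition _ K K0 := Metric.copy (@pointed_by K K0) K.
HB.instance Definition _ K K0 :=
  isPointed.Build (@pointed_by K K0) (projT1 (cid K0)).

Definition borel (K : metricType R) (K0 : [set: K] !=set0) :=
  g_sigma_algebraType (@open (pointed_by K0)).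

Definition similarity_form (K : metricType R) (K0 : [set: K] !=set0)
    (mu nu : {charge set (borel K0) -> \bar R}) : R :=
  charge_integral mu (fun x =>
    charge_integral nu (fun y => expR (- mdist (x : K) (y : K)))).

Definition magnitude (K : metricType R) (K0 : [set: K] !=set0) : \bar R :=
  ereal_sup [set (fine (mu setT) ^+ 2 / similarity_form mu mu)%:E |
    mu in [set mu : {charge set (borel K0) -> \bar R} |
           similarity_form mu mu != 0]].

(* The magnitude is defined for compact positive definite spaces only. *)
Definition has_magnitude (K : metricType R) (m : \bar R) : Prop :=
  [/\ compact [set: K], positive_definite K &
      exists K0 : [set: K] !=set0, m = magnitude K0].

End magnitude.

(* Main.v *)
From HB Require Import structures.
Require Import Defs.
From mathcomp Require Import all_boot all_order all_algebra.
From mathcomp Require Import finmap interval_inference.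
From mathcomp Require Import ring lra.
From mathcomp Require Import all_classical all_reals all_analysis.

Set Implicit Arguments.
Unset Strict Implicit.
Unset Printing Implicit Defensive.

Import Order.TTheory GRing.Theory Num.Theory.
Import numFieldNormedType.Exports.
Local Open Scope classical_set_scope.
Local Open Scope ring_scope.

(** The theorem is Schoenberg's: everything reduces to positive semidefinite
kernels, i.e. symmetric K such that [bform K v v >= 0] for each finite formal
combination [v] of points.

Semidefinite at small scales => negative type.  If Sum c_i = 0, then
0 <= Sum c_i c_j exp(- t d(x_i, x_j)) = - Sum c_i c_j (1 - exp(- t d)), and
dividing by t and letting t -> 0 gives Sum c_i c_j d(x_i, x_j) <= 0
([semidefinite_conditionally_negative]).  For a base point a, the kernel
(d(x, a) + d(y, a) - d(x, y)) / 2 is then semidefinite ([based_kernel_psd]): its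
form at a combination is -1/2 times the form of d at the combination of mass 0
obtained by putting the missing mass at a.  Its reproducing kernel Hilbert space
contains A with d as the squared distance.

The Hilbert space.  It is the dual of the formal combinations with the
semi-norm q(v) = [bform K v v]: the functions f for which
[dualQ f] = sup_v (2 f(v) - q(v)) is finite.  Being a supremum, [dualQ]
satisfies the parallelogram law because (u, v) |-> (u + v, u - v) is a
bijection; it is homogeneous of degree 2; and it passes to pointwise limits.
So the Jordan-von Neumann theorem ([polarDl], [polarZl]) gives an inner product
and completeness is checked pointwise ([rkhs_cauchy_cvg]).

Negative type => positive definite at all scales.  Now
d(x, y) = K(x, x) + K(y, y) - 2 K(x, y) with K semidefinite, so, up to
rescaling the coefficients, exp(- t d) is exp(2 t K).  By the Schur product
theorem ([psd_kernelM]) all powers K^n are semidefinite, hence so is the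
exponential.  If its form vanishes at c, all the forms of K^n do, and then
Sum c_i K(a, x_i)^n = 0 for all n and a by Cauchy-Schwarz.  Taking for a the
point with c <> 0 of largest norm, K(a, a) differs from the other K(a, x_i), and
a polynomial vanishing at the latter only gives c(a) = 0
([exp_kernel_strict]).

Magnitude.  A subspace of a space of negative type is of negative type, hence
positive definite, and a Dirac measure has mass 1 and energy exp(- d(a, a)) = 1,
so the supremum is at least 1 ([magnitude_ge1]). *)

(** * Preliminaries *)

Lemma discriminant_le (R : realFieldType) (a b c : R) : 0 <= c ->
  (forall s, 0 <= a + 2 * b * s + c * s ^+ 2) -> b ^+ 2 <= a * c.
Proof.
rewrite le_eqVlt => /predU1P[<- h|c0 h].
  have [->|b0] := eqVneq b 0; first by rewrite mulr0 expr0n.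
  (* At this s the affine function takes the value -1. *)
  have := h (- (a + 1) / (2 * b)).
  have -> : a + 2 * b * (- (a + 1) / (2 * b)) +
    0 * (- (a + 1) / (2 * b)) ^+ 2 = -1 by field.
  by rewrite oppr_ge0 ler10.
have := h (- b / c).
have -> : a + 2 * b * (- b / c) + c * (- b / c) ^+ 2 = (a * c - b ^+ 2) / c.
  by field; rewrite gt_eqF.
by rewrite pmulr_lge0 ?invr_gt0// subr_ge0.
Qed.

Lemma exists_argmax (R : realType) (S : eqType) (s : seq S) (P : pred S)
    (F : S -> R) : has P s ->
  exists x, [/\ x \in s, P x & forall y, y \in s -> P y -> F y <= F x].
Proof.
elim: s => // x s ih /=.
have [/ih[z [zs Pz zmax]] _|/hasPn sP] := boolP (has P s).
  have [/andP[Px xz]|xz] := boolP (P x && (F z <= F x)).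
    exists x; split=> [||y]; rewrite ?mem_head// inE => /predU1P[->//|ys Py].
    exact: le_trans (zmax _ ys Py) xz.
  exists z; split=> [||y]; rewrite ?inE ?zs ?orbT// => /predU1P[-> Px|].
    by move: xz; rewrite Px /= -ltNge => /ltW.
  exact: zmax.
rewrite orbF => Px; exists x; split=> [||y]; rewrite ?mem_head// inE.
by move=> /predU1P[->//|/sP/negbTE->].
Qed.

Lemma uniq_map_inj_in (S T : eqType) (f : S -> T) (s : seq S) :
  uniq [seq f x | x <- s] -> {in s &, injective f}.
Proof.
move=> us x y xs ys /eqP; rewrite -(nth_index x xs) -(nth_index x ys).
rewrite -!(nth_map _ (f x)) ?index_mem// nth_uniq ?size_map ?index_mem//.
by move=> /eqP ->.
Qed.

(** * Formal linear combinations and positive semidefinite kernels *)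

Section linear_combinations.
Context {R : realType} {T : Type}.
Implicit Types (u v : seq (R * T)) (f g : T -> R) (K : T -> T -> R).

(** A finitely supported signed measure is encoded as a list of weighted points,
in which a point may be repeated: sums are concatenations, and [lcomb] is
integration. *)
Definition lcomb v f : R := \sum_(p <- v) p.1 * f p.2.

Definition scalec (c : R) v := [seq (c * p.1, p.2) | p <- v].

Definition bform K u v := lcomb u (fun x => lcomb v (K x)).

Definition psd_kernel K :=
  (forall x y, K x y = K y x) /\ forall v, 0 <= bform K v v.

Lemma eq_lcomb v f g : f =1 g -> lcomb v f = lcomb v g.
Proof. by move=> fg; apply: eq_bigr => p _; rewrite fg. Qed.

Lemma lcomb_cat u v f : lcomb (u ++ v) f = lcomb u f + lcomb v f.
Proof. by rewrite /lcomb big_cat. Qed.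

Lemma lcomb_scale c v f : lcomb (scalec c v) f = c * lcomb v f.
Proof.
by rewrite /lcomb big_map mulr_sumr; apply: eq_bigr => p _; rewrite mulrA.
Qed.

Lemma lcomb1 c x f : lcomb [:: (c, x)] f = c * f x.
Proof. by rewrite /lcomb big_seq1. Qed.

Lemma lcombD v f g : lcomb v (fun x => f x + g x) = lcomb v f + lcomb v g.
Proof. by rewrite /lcomb -big_split; apply: eq_bigr => p _; rewrite mulrDr. Qed.

Lemma lcombZ v c f : lcomb v (fun x => c * f x) = c * lcomb v f.
Proof. by rewrite /lcomb mulr_sumr; apply: eq_bigr => p _; rewrite mulrCA. Qed.

Lemma lcombN v f : lcomb v (fun x => - f x) = - lcomb v f.
Proof. by rewrite /lcomb -sumrN; apply: eq_bigr => p _; rewrite mulrN. Qed.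

Lemma lcombMr v f c : lcomb v (fun x => f x * c) = lcomb v f * c.
Proof. by rewrite /lcomb mulr_suml; apply: eq_bigr => p _; rewrite mulrA. Qed.

Lemma lcomb_map (h : T -> R) v f :
  lcomb [seq (p.1 * h p.2, p.2) | p <- v] f = lcomb v (fun x => h x * f x).
Proof. by rewrite /lcomb big_map; apply: eq_bigr => p _; rewrite mulrA. Qed.

Lemma lcomb_exchange K u v :
  lcomb u (fun x => lcomb v (K x)) = lcomb v (fun y => lcomb u (K^~ y)).
Proof.
rewrite /lcomb; under eq_bigr do rewrite mulr_sumr.
rewrite exchange_big /=; apply: eq_bigr => p _.
by rewrite mulr_sumr; apply: eq_bigr => q _; rewrite mulrCA.
Qed.

Lemma lcomb_cvg (I : Type) (F : set_system I) (FF : Filter F)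
    (f : I -> T -> R) g v : (forall x, f i x @[i --> F] --> g x) ->
  lcomb v (f i) @[i --> F] --> lcomb v g.
Proof.
move=> fg; rewrite /lcomb; elim: v => [|p v ih].
  rewrite big_nil; under eq_fun do rewrite big_nil; exact: cvg_cst.
rewrite big_cons; under eq_fun do rewrite big_cons.
by apply: cvgD => //; apply: cvgM => //; exact: cvg_cst.
Qed.

Section psd.
Variables (K : T -> T -> R) (Kpsd : psd_kernel K).

Lemma bformC u v : bform K u v = bform K v u.
Proof.
rewrite /bform lcomb_exchange; apply: eq_lcomb => y; apply: eq_lcomb => x.
exact: Kpsd.1.
Qed.

Lemma bform_catl u v w : bform K (u ++ v) w = bform K u w + bform K v w.
Proof. exact: lcomb_cat. Qed.

Lemma bform_catr u v w : bform K w (u ++ v) = bform K w u + bform K w v.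
Proof. by rewrite bformC bform_catl !(bformC w). Qed.

Lemma bform_scalel c u v : bform K (scalec c u) v = c * bform K u v.
Proof. exact: lcomb_scale. Qed.

Lemma bform_scaler c u v : bform K u (scalec c v) = c * bform K u v.
Proof. by rewrite bformC bform_scalel bformC. Qed.

Definition bformE :=
  (bform_catl, bform_catr, bform_scalel, bform_scaler).

Lemma bform_CauchySchwarz u v :
  bform K u v ^+ 2 <= bform K u u * bform K v v.
Proof.
apply: discriminant_le => [|s]; first exact: Kpsd.2.
have := Kpsd.2 (u ++ scalec s v).
rewrite !bformE (bformC v u); congr (_ <= _); ring.
Qed.

Lemma psd_kernel_diag x : 0 <= K x x.
Proof. by have := Kpsd.2 [:: (1, x)]; rewrite /bform !lcomb1 !mul1r. Qed.

Lemma lcomb_kernel_le a v : lcomb v (K a) ^+ 2 <= K a a * bform K v v.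
Proof.
by have := bform_CauchySchwarz [:: (1, a)] v; rewrite /bform !lcomb1 !mul1r.
Qed.

Lemma psd_kernel_vanish a : K a a = 0 -> forall y, K a y = 0.
Proof.
move=> a0 y; have := lcomb_kernel_le a [:: (1, y)].
by rewrite a0 mul0r lcomb1 mul1r exprn_even_le0//= => /eqP.
Qed.

End psd.

Lemma psd_kernel1 : psd_kernel (fun _ _ : T => 1).
Proof.
split=> // v; rewrite /bform.
have -> : lcomb v (fun=> lcomb v (fun=> 1)) = lcomb v (fun=> 1) ^+ 2.
  by rewrite expr2 -lcombMr; apply: eq_lcomb => x; rewrite mul1r.
exact: sqr_ge0.
Qed.

End linear_combinations.

Section schur.
Context {R : realType} {T : eqType}.
Implicit Types (K L : T -> T -> R) (v : seq (R * T)).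

(** Gaussian elimination: subtracting the rank one kernel
K(x, a) K(a, y) / K(a, a) from K keeps it semidefinite and kills the point a,
while a rank one kernel times L is L with rescaled weights.  The list P holds
the points of [v] that are not yet killed. *)
Lemma psd_kernelM_on L : psd_kernel L ->
  forall (P : seq T) K, psd_kernel K ->
  forall v, (forall p, p \in v -> p.2 \in P \/ forall y, K p.2 y = 0) ->
  0 <= bform (fun x y => K x y * L x y) v v.
Proof.
move=> Lpsd; elim=> [K Kpsd v vP|a P ih K Kpsd v vP].
  rewrite /bform /lcomb big1_seq// => p /andP[_ /vP[//|p0]].
  by rewrite big1 ?mulr0// => q _; rewrite p0 mul0r mulr0.
have [a0|a0] := eqVneq (K a a) 0.
  apply: ih => // p /vP[|]; last by right.
  rewrite inE => /predU1P[->|]; last by left.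
  by right; exact: psd_kernel_vanish.
have a_gt0 : 0 < K a a by rewrite lt0r a0 psd_kernel_diag.
pose K' x y := K x y - (K a a)^-1 * (K x a * K a y).
have K'psd : psd_kernel K'.
  split=> [x y|w].
    by rewrite /K' (Kpsd.1 x y) (Kpsd.1 x a) (Kpsd.1 a y) (mulrC (K a x)).
  have -> : bform K' w w = bform K w w - (K a a)^-1 * lcomb w (K a) ^+ 2.
    rewrite /bform /K'.
    under eq_lcomb do rewrite lcombD lcombN lcombZ lcombZ Kpsd.1.
    rewrite lcombD lcombN lcombZ lcombMr -expr2.
    by congr (_ - _); apply: eq_lcomb => x; apply: eq_lcomb => y; exact: Kpsd.1.
  by rewrite subr_ge0 mulrC ler_pdivrMr// mulrC lcomb_kernel_le.
pose w := [seq (p.1 * K a p.2, p.2) | p <- v].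
have -> : bform (fun x y => K x y * L x y) v v =
    bform (fun x y => K' x y * L x y) v v + (K a a)^-1 * bform L w w.
  rewrite /bform /w lcomb_map -lcombZ -lcombD; apply: eq_lcomb => x.
  rewrite lcomb_map -lcombZ -lcombZ -lcombD; apply: eq_lcomb => y.
  rewrite /K' (Kpsd.1 x a); ring.
rewrite addr_ge0 ?mulr_ge0 ?invr_ge0 ?(ltW a_gt0)//; last exact: Lpsd.2.
apply: ih => // p /vP[|p0].
  rewrite inE => /predU1P[->|]; last by left.
  by right=> y; rewrite /K' mulrA mulVf// mul1r subrr.
by right=> y; rewrite /K' !p0 mul0r mulr0 subr0.
Qed.

(** The Schur product theorem. *)
Lemma psd_kernelM K L : psd_kernel K -> psd_kernel L ->
  psd_kernel (fun x y => K x y * L x y).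
Proof.
move=> Kpsd Lpsd; split=> [x y|v]; first by rewrite Kpsd.1 Lpsd.1.
apply: (@psd_kernelM_on L Lpsd [seq p.2 | p <- v]) => // p pv.
by left; exact: map_f.
Qed.

Lemma psd_kernelX K n : psd_kernel K -> psd_kernel (fun x y => K x y ^+ n).
Proof.
move=> Kpsd; elim: n => [|n ih]; first exact: psd_kernel1.
by under eq_fun do under eq_fun do rewrite exprS; exact: psd_kernelM.
Qed.

Lemma bform_exp_cvg K c v :
  \sum_(0 <= k < n) c ^+ k / k`!%:R * bform (fun x y => K x y ^+ k) v v
    @[n --> \oo] --> bform (fun x y => expR (c * K x y)) v v.
Proof.
pose S n x y := \sum_(0 <= k < n) c ^+ k / k`!%:R * K x y ^+ k.
have SE n : bform (S n) v v =
    \sum_(0 <= k < n) c ^+ k / k`!%:R * bform (fun x y => K x y ^+ k) v v.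
  elim: n => [|n ih].
    rewrite big_geq// /bform /lcomb big1// => p _.
    by rewrite big1 ?mulr0// => q _; rewrite /S big_geq ?mulr0.
  rewrite big_nat_recr//= -ih /bform -lcombZ -lcombD; apply: eq_lcomb => x.
  by rewrite -lcombZ -lcombD; apply: eq_lcomb => y; rewrite /S big_nat_recr.
under eq_fun do rewrite -SE.
apply: lcomb_cvg => x; apply: lcomb_cvg => y.
have -> : (fun n => S n x y) = series (exp_coeff (c * K x y)).
  apply/funext => n; rewrite /series /=; apply: eq_bigr => k _.
  by rewrite /exp_coeff /= exprMn mulrAC.
exact: is_cvg_series_exp_coeff.
Qed.

End schur.

(** * Strict positivity of exponential kernels *)

Section exponential_kernel.
Context {R : realType} {T : eqType}.
Implicit Types (K L : T -> T -> R) (v : seq (R * T)).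

(** All the terms of the exponential series are nonnegative, so each one is a
lower bound. *)
Lemma bform_exp_ge K c v n : psd_kernel K -> 0 <= c ->
  c ^+ n / n`!%:R * bform (fun x y => K x y ^+ n) v v <=
  bform (fun x y => expR (c * K x y)) v v.
Proof.
move=> Kpsd c0; apply: (cvgr_to_ge (@bform_exp_cvg _ _ K c v)).
have term_ge0 k : 0 <= c ^+ k / k`!%:R * bform (fun x y => K x y ^+ k) v v.
  apply: mulr_ge0; first by rewrite divr_ge0 ?exprn_ge0.
  by case: (psd_kernelX k Kpsd) => _; apply.
near=> m.
rewrite (@big_cat_nat _ _ _ n.+1)//=; last by near: m; exists n.+1.
rewrite big_nat_recr//= -addrA addrCA lerDl addr_ge0// sumr_ge0//.
Unshelve. all: by end_near. Qed.

Lemma lcomb_horner v (r : T -> R) :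
  (forall n, lcomb v (fun x => r x ^+ n) = 0) ->
  forall P : {poly R}, lcomb v (fun x => P.[r x]) = 0.
Proof.
move=> r0 P; elim/poly_ind: P v r0 => [|P c ih] v r0.
  by rewrite /lcomb big1// => p _; rewrite horner0 mulr0.
under eq_lcomb do rewrite hornerMXaddC mulrC.
rewrite lcombD -lcomb_map ih ?add0r; last first.
  move=> n; rewrite lcomb_map -(r0 n.+1).
  by apply: eq_lcomb => x; rewrite exprS.
rewrite -[RHS](mulr0 c) -(r0 0) -lcombZ; apply: eq_lcomb => x.
by rewrite expr0 mulr1.
Qed.

(** The exponential of a semidefinite kernel is strictly positive definite on
points at positive squared distance K(x, x) + K(y, y) - 2 K(x, y): the rows of
the powers of K at one well-chosen point determine the weight of that point. *)
Lemma exp_kernel_strict K c v : psd_kernel K -> 0 < c ->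
  (forall x y, x != y -> 2 * K x y < K x x + K y y) ->
  uniq [seq p.2 | p <- v] -> has (fun p => p.1 != 0) v ->
  0 < bform (fun x y => expR (c * K x y)) v v.
Proof.
move=> Kpsd c0 Kneq uv /hasP[p1 p1v p10]; rewrite ltNge; apply/negP => v0.
have power0 n : bform (fun x y => K x y ^+ n) v v = 0.
  apply/eqP; rewrite eq_le (psd_kernelX n Kpsd).2 andbT.
  have := le_trans (bform_exp_ge v n Kpsd (ltW c0)) v0.
  by rewrite pmulr_rle0// divr_gt0// ?exprn_gt0// ltr0n fact_gt0.
(* At a point a of largest norm K a a, the other values of K a are smaller. *)
have [p0 [p0v p00 p0max]] : exists p0, [/\ p0 \in v, p0.1 != 0 &
    forall p, p \in v -> p.1 != 0 -> K p.2 p.2 <= K p0.2 p0.2].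
  apply: (exists_argmax (P := fun p => p.1 != 0) (fun p => K p.2 p.2)).
  by apply/hasP; exists p1.
pose a := p0.2; pose r x := K a x.
have r0 n : lcomb v (fun x => r x ^+ n) = 0.
  have := lcomb_kernel_le (psd_kernelX n Kpsd) a v.
  by rewrite power0 mulr0 exprn_even_le0//= => /eqP.
pose others := [seq p <- v | (p.1 != 0) && (p != p0)].
pose P := \prod_(p <- others) ('X - (r p.2)%:P).
have := lcomb_horner r0 P.
rewrite /lcomb (bigD1_seq p0) ?(map_uniq uv)//= -/a big1_seq ?addr0; last first.
  move=> p /andP[pp0 pv]; have [->|p_neq0] := eqVneq p.1 0.
    by rewrite mul0r.
  rewrite /P horner_prod (big_rem p)/=; last first.
    by rewrite mem_filter p_neq0 pp0.
  by rewrite hornerXsubC subrr mul0r mulr0.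
apply/eqP; rewrite mulf_neq0// /P horner_prod prodf_seq_neq0.
apply/allP => p; rewrite mem_filter => /andP[/andP[p_neq0 pp0] pv] /=.
rewrite hornerXsubC subr_eq0 eq_sym lt_eqF//.
have ap : a != p.2.
  by apply: contra pp0 => /eqP ap; apply/eqP/(uniq_map_inj_in uv).
have := Kneq _ _ ap; have := p0max _ pv p_neq0; rewrite -/a /r; lra.
Qed.

End exponential_kernel.

(** * Forms of kernels and quadratic forms of matrices *)

Section similarity_matrices.
Context {R : realType}.

Lemma bform_mx (A : choiceType) (B : {fset A}) (K : A -> A -> R)
    (v : 'rV[R]_#|{: B}|) :
  (v *m (\matrix_(i, j) K (val (enum_val i)) (val (enum_val j))) *m v^T) 0 0 =
  let w := [seq (v 0 i, val (enum_val i)) | i <- index_enum 'I_#|{: B}|] in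
  bform K w w.
Proof.
rewrite mxE /bform /lcomb big_map /=.
under [LHS]eq_bigr do rewrite mxE mulr_suml.
rewrite exchange_big /=; apply: eq_bigr => i _.
rewrite big_map mulr_sumr; apply: eq_bigr => j _.
by rewrite !mxE -mulrA (mulrC _ (v 0 j)).
Qed.

(** Repeated points are merged by adding up their weights. *)
Lemma lcomb_fset (A : choiceType) (w : seq (R * A)) (f : A -> R) :
  let B := seq_fset tt [seq p.2 | p <- w] in
  let c x := \sum_(p <- w | p.2 == x) p.1 in
  lcomb w f = lcomb [seq (c (val (enum_val i)), val (enum_val i)) |
                     i <- index_enum 'I_#|{: B}|] f.
Proof.
move=> B c; rewrite /lcomb big_map /=.
under [RHS]eq_bigr do rewrite /c mulr_suml.
under [RHS]eq_bigr do rewrite big_mkcond.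
rewrite exchange_big /= !big_seq; apply: eq_bigr => p pw.
have pB : p.2 \in B by rewrite seq_fsetE map_f.
rewrite -big_mkcond (big_pred1 (enum_rank [` pB]%fset)) /=.
  by rewrite enum_rankK.
move=> i; rewrite /= -(inj_eq enum_val_inj) enum_rankK -val_eqE /= eq_sym.
by [].
Qed.

Lemma semidefinite_mx_bform (A : choiceType) (K : A -> A -> R) :
  (forall (B : {fset A}) (v : 'rV[R]_#|{: B}|), B != fset0 ->
    0 <= (v *m (\matrix_(i, j) K (val (enum_val i)) (val (enum_val j)))
            *m v^T) 0 0) ->
  forall w : seq (R * A), 0 <= bform K w w.
Proof.
move=> K0 w; pose B := seq_fset tt [seq p.2 | p <- w].
case: w @B => [|p w'] B; first by rewrite /bform /lcomb big_nil.
set w := p :: w' in B *.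
pose v : 'rV[R]_#|{: B}| :=
  \row_i \sum_(p <- w | p.2 == val (enum_val i)) p.1.
have B0 : B != fset0.
  by apply/fset0Pn; exists p.2; rewrite seq_fsetE map_f// inE eqxx.
have := K0 B v B0; rewrite bform_mx /= /bform.
under eq_map do rewrite mxE.
by rewrite -lcomb_fset; under eq_lcomb do rewrite -lcomb_fset.
Qed.

End similarity_matrices.

(** * The Jordan-von Neumann theorem *)

(** Subtracting s * h 1 leaves an additive function g that vanishes on the
naturals, hence is 1-periodic and bounded on s >= 0; as g(n s) = n g(s), a
bounded additive function is 0. *)
Lemma bounded_additive_linear (R : realType) (h : R -> R) (M : R) :
  (forall s t, h (s + t) = h s + h t) ->
  (forall s, 0 <= s <= 1 -> `|h s| <= M) ->
  forall s, h s = s * h 1.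
Proof.
move=> hD hM.
pose g s := h s - s * h 1.
have gD s t : g (s + t) = g s + g t by rewrite /g hD; ring.
have g0 : g 0 = 0 by have := gD 0 0; rewrite addr0; lra.
have g1 n : g n%:R = 0.
  elim: n => // n ih; rewrite -addn1 natrD gD ih /g; ring.
have gn s n : g (n%:R * s) = n%:R * g s.
  elim: n => [|n ih]; first by rewrite !mul0r.
  by rewrite -addn1 natrD !mulrDl gD ih !mul1r.
pose C := M + `|h 1|.
have gC s : 0 <= s -> `|g s| <= C.
  move=> s0; have /andP[ns sn] := truncn_itv s0; set n := Num.truncn s in ns sn.
  have -> : g s = g (s - n%:R).
    by have := gD (s - n%:R) n%:R; rewrite subrK g1 addr0.
  have sn1 : 0 <= s - n%:R <= 1.
    by rewrite subr_ge0 ns/= lerBlDl natr1 ltW.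
  rewrite /g (le_trans (ler_normB _ _))// lerD ?hM//.
  by case/andP: sn1 => s0' s1'; rewrite normrM ger0_norm// ler_piMl.
have gpos s : 0 <= s -> g s = 0.
  move=> s0; apply/eqP; rewrite -normr_le0 leNgt; apply/negP => gs.
  have C0 : 0 <= C / `|g s| by rewrite divr_ge0// (le_trans _ (gC 0 _)).
  have := archi_boundP C0; rewrite ltr_pdivrMr//; apply/negP; rewrite -leNgt.
  by rewrite -(ger0_norm (ler0n _ _)) -normrM -gn gC// mulr_ge0.
move=> s; apply/eqP; rewrite -subr_eq0 -/(g s); apply/eqP.
have [/gpos//|/ltW s0] := leP 0 s.
by have := gD s (- s); rewrite subrr g0 (gpos (- s)) ?oppr_ge0// addr0.
Qed.

Section jordan_von_neumann.
Context {R : realType} {V : lmodType R} (Q : V -> R).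
Hypothesis Q_ge0 : forall u, 0 <= Q u.
Hypothesis QZ : forall c u, Q (c *: u) = c ^+ 2 * Q u.
Hypothesis parallelogram :
  forall u v, Q (u + v) + Q (u - v) = 2 * Q u + 2 * Q v.

Definition polar u v : R := (Q (u + v) - Q (u - v)) / 4.

Let Q0 : Q 0 = 0.
Proof. by rewrite -(scale0r 0) QZ expr0n mul0r. Qed.

Let QN u : Q (- u) = Q u.
Proof. by rewrite -scaleN1r QZ sqrrN expr1n mul1r. Qed.

Lemma polarC u v : polar u v = polar v u.
Proof. by rewrite /polar (addrC v) -(opprB v u) QN. Qed.

Lemma polarxx u : polar u u = Q u.
Proof.
have -> : polar u u = Q (2 *: u) / 4.
  by rewrite /polar subrr Q0 subr0 scaler_nat.
by rewrite QZ; field.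
Qed.

(** The parallelogram law gives polar (a + b) + polar (a - b) = 2 polar a;
at a = (u + v) / 2 and b = (u - v) / 2 this compares polar u + polar v with
2 polar ((u + v) / 2), which is polar (u + v) by the case a = b. *)
Lemma polarDl u v w : polar (u + v) w = polar u w + polar v w.
Proof.
have polar_mid a b : polar (a + b) w + polar (a - b) w = 2 * polar a w.
  have := parallelogram (a + w) b; have := parallelogram (a - w) b.
  rewrite /polar (addrAC a w) (addrAC a (- w)) (addrAC a w) (addrAC a (- w)).
  lra.
have polar0 : polar 0 w = 0 by rewrite /polar add0r sub0r QN subrr mul0r.
have := polar_mid (2^-1 *: (u + v)) (2^-1 *: (u + v)).
have := polar_mid (2^-1 *: (u + v)) (2^-1 *: (u - v)).
rewrite subrr polar0 addr0 -!scalerDr -!scalerBr.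
have half a : 2^-1 *: (a + a) = a :> V.
  have -> : a + a = 2 *: a by rewrite scaler_nat mulr2n.
  by rewrite scalerA mulVf ?scale1r.
rewrite half.
have -> : u + v + (u - v) = u + u by rewrite addrACA subrr addr0.
have -> : u + v - (u - v) = v + v by rewrite opprB addrC addrA subrK.
by rewrite !half => -> ->.
Qed.

Lemma polarZl c u w : polar (c *: u) w = c * polar u w.
Proof.
rewrite -[in RHS](scale1r u).
apply: (bounded_additive_linear (h := fun s => polar (s *: u) w)
          (M := Q u + Q w)) => [s t|s /andP[s0 s1]].
  by rewrite scalerDl polarDl.
have := parallelogram (s *: u) w; have := Q_ge0 (s *: u + w).
have := Q_ge0 (s *: u - w); have : Q (s *: u) <= Q u.
  by rewrite QZ ler_piMl// expr_le1.
rewrite ler_norml /polar => ? ? ? ?; apply/andP; split; lra.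
Qed.

Lemma polar_CauchySchwarz u v : polar u v ^+ 2 <= Q u * Q v.
Proof.
apply: discriminant_le => // s; have := Q_ge0 (u + s *: v).
rewrite -polarxx polarDl !(polarC _ (_ + _)) !polarDl !polarZl.
rewrite !(polarC _ (_ *: _)) !polarZl !polarxx (polarC v); congr (_ <= _); ring.
Qed.

Lemma sqrt_quadratic_triangle u v :
  Num.sqrt (Q (u + v)) <= Num.sqrt (Q u) + Num.sqrt (Q v).
Proof.
rewrite -(@ler_pXn2r _ 2)// ?nnegrE ?addr_ge0 ?sqrtr_ge0//.
rewrite sqr_sqrtr// sqrrD !sqr_sqrtr// -sqrtrM//.
have -> : Q (u + v) = Q u + polar u v *+ 2 + Q v.
  rewrite -polarxx polarDl !(polarC _ (_ + _)) !polarDl !polarxx (polarC v).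
  ring.
rewrite lerD2r lerD2l lerMn2r /=.
rewrite (le_trans (ler_norm _))// -sqrtr_sqr ler_wsqrtr//.
exact: polar_CauchySchwarz.
Qed.

End jordan_von_neumann.

(** * The dual of a semidefinite form *)

Section dual_quadratic_form.
Context {R : realType} {T : Type}.
Variables (K : T -> T -> R) (Kpsd : psd_kernel K).
Implicit Types (f g : T -> R^o) (u v : seq (R * T)).

(** The squared dual norm of f is written as a Legendre transform,
sup_v (2 f(v) - q(v)), instead of sup_v f(v)^2 / q(v): no division by a
possibly zero q(v) occurs, and the parallelogram law can be proved term by
term. *)
Definition legendre f v : R := 2 * lcomb v f - bform K v v.

(** Being bounded for the semi-norm sqrt q. *)
Definition in_rkhs f := exists C, forall v, legendre f v <= C.

Definition dualQ f : R := sup (range (legendre f)).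

Lemma legendre_nil f : legendre f [::] = 0.
Proof. by rewrite /legendre /bform /lcomb !big_nil mulr0 subr0. Qed.

Lemma legendre_le f v : in_rkhs f -> legendre f v <= dualQ f.
Proof.
move=> [C fC]; apply: ub_le_sup; last by exists v.
by exists C => _ [w _ <-].
Qed.

Lemma dualQ_le f C : (forall v, legendre f v <= C) -> dualQ f <= C.
Proof.
move=> fC; apply: ge_sup; first by exists (legendre f [::]), [::].
by move=> _ [v _ <-].
Qed.

Lemma dualQ_ge0 f : in_rkhs f -> 0 <= dualQ f.
Proof. by move=> fH; rewrite -(legendre_nil f) legendre_le. Qed.

Lemma legendreZ_le f c v : in_rkhs f ->
  legendre (c *: f) v <= c ^+ 2 * dualQ f.
Proof.
move=> fH; have [->|c0] := eqVneq c 0.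
  rewrite expr0n mul0r /legendre scale0r.
  have -> : lcomb v 0 = 0 by rewrite /lcomb big1// => p _; rewrite mulr0.
  by rewrite mulr0 add0r oppr_le0; exact: Kpsd.2.
have -> : legendre (c *: f) v = c ^+ 2 * legendre f (scalec c^-1 v).
  rewrite /legendre !(bformE Kpsd) lcomb_scale.
  have -> : lcomb v (c *: f) = c * lcomb v f by exact: lcombZ.
  by field.
by rewrite ler_wpM2l ?sqr_ge0// legendre_le.
Qed.

Lemma in_rkhsZ f c : in_rkhs f -> in_rkhs (c *: f).
Proof. by move=> fH; exists (c ^+ 2 * dualQ f) => v; exact: legendreZ_le. Qed.

Lemma dualQZ f c : in_rkhs f -> dualQ (c *: f) = c ^+ 2 * dualQ f.
Proof.
move=> fH.
have Zle g b : in_rkhs g -> dualQ (b *: g) <= b ^+ 2 * dualQ g.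
  by move=> gH; apply: dualQ_le => v; exact: legendreZ_le.
have [->|c0] := eqVneq c 0.
  apply/eqP; rewrite eq_le Zle//= expr0n mul0r.
  by apply: dualQ_ge0; exact: in_rkhsZ.
apply/eqP; rewrite eq_le Zle//=.
have := Zle _ c^-1 (in_rkhsZ c fH); rewrite scalerA mulVf// scale1r exprVn.
by rewrite mulrC ler_pdivlMr ?exprn_even_gt0// mulrC.
Qed.

(** Evaluate f at (u + v) / 2 and g at (u - v) / 2, and use the parallelogram
identity of q. *)
Lemma legendre_parallelogram f g u v : in_rkhs f -> in_rkhs g ->
  legendre (f + g) u + legendre (f - g) v <= 2 * dualQ f + 2 * dualQ g.
Proof.
move=> fH gH; have lD w h k : lcomb w (h + k) = lcomb w h + lcomb w k.
  exact: lcombD.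
have lN w h : lcomb w (- h) = - lcomb w h by exact: lcombN.
have := legendre_le (scalec 2^-1 (u ++ v)) fH.
have := legendre_le (scalec 2^-1 (u ++ scalec (-1) v)) gH.
rewrite /legendre !(bformE Kpsd) !lcomb_scale !lcomb_cat !lcomb_scale !lD lN.
rewrite (bformC Kpsd v u); lra.
Qed.

Lemma in_rkhsD f g : in_rkhs f -> in_rkhs g -> in_rkhs (f + g).
Proof.
move=> fH gH; exists (2 * dualQ f + 2 * dualQ g) => v.
by have := legendre_parallelogram v [::] fH gH; rewrite legendre_nil addr0.
Qed.

Lemma in_rkhsB f g : in_rkhs f -> in_rkhs g -> in_rkhs (f - g).
Proof.
by move=> fH gH; rewrite -scaleN1r; apply: in_rkhsD => //; exact: in_rkhsZ.
Qed.

(** One inequality suffices: applied to f + g and f - g, it becomes the reverse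
one for f and g. *)
Lemma dualQ_parallelogram f g : in_rkhs f -> in_rkhs g ->
  dualQ (f + g) + dualQ (f - g) = 2 * dualQ f + 2 * dualQ g.
Proof.
have le f' g' : in_rkhs f' -> in_rkhs g' ->
    dualQ (f' + g') + dualQ (f' - g') <= 2 * dualQ f' + 2 * dualQ g'.
  move=> fH gH; rewrite -lerBrDr; apply: dualQ_le => u.
  rewrite lerBrDl -lerBrDr; apply: dualQ_le => v.
  by rewrite lerBrDl; exact: legendre_parallelogram.
move=> fH gH; apply/eqP; rewrite eq_le le//=.
have := le _ _ (in_rkhsD fH gH) (in_rkhsB fH gH).
have -> : f + g + (f - g) = 2 *: f by rewrite addrACA subrr addr0 scaler_nat.
have -> : f + g - (f - g) = 2 *: g.
  by rewrite opprB addrC addrA subrK scaler_nat.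
by rewrite !dualQZ//; lra.
Qed.

Lemma lcomb_dualQ_le f v : in_rkhs f -> lcomb v f ^+ 2 <= dualQ f * bform K v v.
Proof.
move=> fH; apply: discriminant_le => [|s]; first exact: Kpsd.2.
have := legendre_le (scalec (- s) v) fH.
by rewrite /legendre !(bformE Kpsd) lcomb_scale; lra.
Qed.

Lemma dualQ_eq0 f : in_rkhs f -> dualQ f = 0 -> f = 0.
Proof.
move=> fH f0; apply/funext => x.
have := lcomb_dualQ_le [:: (1, x)] fH.
by rewrite f0 mul0r lcomb1 mul1r exprn_even_le0//= => /eqP.
Qed.

Definition kernel_section u : T -> R^o := fun x => lcomb u (K x).

Lemma lcomb_kernel_section u v : lcomb v (kernel_section u) = bform K v u.
Proof. by []. Qed.

(** This is q(u - v) >= 0, with equality at v = u, so that [kernel_section]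
embeds the formal combinations isometrically into their dual. *)
Lemma legendre_kernel_section_le u v :
  legendre (kernel_section u) v <= bform K u u.
Proof.
have := Kpsd.2 (u ++ scalec (-1) v).
by rewrite /legendre lcomb_kernel_section !(bformE Kpsd) (bformC Kpsd u v); lra.
Qed.

Lemma kernel_section_in_rkhs u : in_rkhs (kernel_section u).
Proof. by exists (bform K u u); exact: legendre_kernel_section_le. Qed.

Lemma dualQ_kernel_section u : dualQ (kernel_section u) = bform K u u.
Proof.
apply/eqP; rewrite eq_le dualQ_le; last exact: legendre_kernel_section_le.
have := legendre_le u (kernel_section_in_rkhs u).
by rewrite /legendre lcomb_kernel_section; lra.
Qed.

End dual_quadratic_form.

(** * The reproducing kernel Hilbert space *)

Section rkhs.
Context {R : realType} {T : Type}.
Variables (K : T -> T -> R) (Kpsd : psd_kernel K).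

Definition rkhs_pred : {pred T -> R^o} := fun f => `[< in_rkhs K f >].

(** The type carries the proof [KP], on which its norm structure depends. *)
Record rkhs (KP : psd_kernel K) :=
  Rkhs { rkhs_fun : T -> R^o; _ : rkhs_fun \in rkhs_pred }.

HB.instance Definition _ := [isSub for @rkhs_fun Kpsd].
HB.instance Definition _ := [Choice of rkhs Kpsd by <:].

Lemma rkhs_submod : submod_closed rkhs_pred.
Proof.
split=> [|c f g /asboolP fH /asboolP gH].
  apply/asboolP; exists 0 => v; rewrite /legendre.
  have -> : lcomb v 0 = 0 by rewrite /lcomb big1// => p _; rewrite mulr0.
  by rewrite mulr0 add0r oppr_le0; exact: Kpsd.2.
by apply/asboolP; apply: in_rkhsD => //; exact: in_rkhsZ.
Qed.

HB.instance Definition _ :=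
  GRing.isSubmodClosed.Build R (T -> R^o) rkhs_pred rkhs_submod.
HB.instance Definition _ := [SubChoice_isSubLmodule of rkhs Kpsd by <:].

Lemma rkhsP (f : rkhs Kpsd) : in_rkhs K (rkhs_fun f).
Proof. exact/asboolP/(valP f). Qed.

Definition rkhsQ (f : rkhs Kpsd) : R := dualQ K (rkhs_fun f).

Lemma rkhsQ_ge0 f : 0 <= rkhsQ f.
Proof. exact/dualQ_ge0/rkhsP. Qed.

Lemma rkhsQZ c f : rkhsQ (c *: f) = c ^+ 2 * rkhsQ f.
Proof. exact/(dualQZ Kpsd)/rkhsP. Qed.

Lemma rkhsQ_parallelogram f g :
  rkhsQ (f + g) + rkhsQ (f - g) = 2 * rkhsQ f + 2 * rkhsQ g.
Proof. by apply: (dualQ_parallelogram Kpsd); exact: rkhsP. Qed.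

Lemma rkhsQ_eq0 f : rkhsQ f = 0 -> f = 0.
Proof. by move=> f0; apply: val_inj; apply: (dualQ_eq0 Kpsd (rkhsP f)). Qed.

Definition rkhs_norm f : R := Num.sqrt (rkhsQ f).

Lemma rkhs_norm_triangle f g :
  rkhs_norm (f + g) <= rkhs_norm f + rkhs_norm g.
Proof.
exact: (sqrt_quadratic_triangle rkhsQ_ge0 rkhsQZ rkhsQ_parallelogram).
Qed.

Lemma rkhs_normZ c f : rkhs_norm (c *: f) = `|c| * rkhs_norm f.
Proof. by rewrite /rkhs_norm rkhsQZ sqrtrM ?sqr_ge0// sqrtr_sqr. Qed.

Lemma rkhs_norm0_eq0 f : rkhs_norm f = 0 -> f = 0.
Proof.
move/eqP; rewrite sqrtr_eq0 => f0; apply: rkhsQ_eq0; apply/eqP.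
by rewrite eq_le f0 rkhsQ_ge0.
Qed.

HB.instance Definition _ := Lmodule_isNormed.Build R (rkhs Kpsd)
  rkhs_norm_triangle rkhs_normZ rkhs_norm0_eq0.

Lemma rkhs_eval_le (f : rkhs Kpsd) x :
  `|rkhs_fun f x| <= `|f| * Num.sqrt (K x x).
Proof.
have := lcomb_dualQ_le Kpsd [:: (1, x)] (rkhsP f).
rewrite /bform !lcomb1 !mul1r => /ler_wsqrtr.
by rewrite sqrtr_sqr sqrtrM//; exact: rkhsQ_ge0.
Qed.

(** A Cauchy filter converges pointwise, since evaluations are bounded, and the
pointwise limit is in the space and is the limit in norm. *)
Lemma rkhs_cauchy_cvg (F : set_system (rkhs Kpsd)) :
  ProperFilter F -> cauchy F -> cvg F.
Proof.
move=> FF /(@cauchyP R) Fc.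
have Fclose e : 0 < e ->
    exists f0 : rkhs Kpsd, \forall f \near F, `|f0 - f| <= e.
  move=> /Fc[f0 f0F]; exists f0; near=> f.
  have : ball f0 e f by near: f.
  by rewrite -ball_normE => /ltW.
have eval_cvg x : cvg ((fun f : rkhs Kpsd => rkhs_fun f x : R) @ F).
  apply: cauchy_cvg; apply: (@cauchy_exP R) => e e0.
  have S0 : 0 < Num.sqrt (K x x) + 1 by rewrite ltr_wpDl// sqrtr_ge0.
  have d0 : 0 < e / 2 / (Num.sqrt (K x x) + 1) by rewrite !divr_gt0.
  have [f0 f0F] := Fclose _ d0.
  exists (rkhs_fun f0 x).
  change (\forall f \near F, ball (rkhs_fun f0 x) e (rkhs_fun f x)).
  near=> f.
  have := rkhs_eval_le (f0 - f) x.
  have : `|f0 - f| <= e / 2 / (Num.sqrt (K x x) + 1) by near: f.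
  rewrite ler_pdivlMr// mulrDr mulr1 -ball_normE /= => f0f f0fx.
  rewrite -[X in `|X|]/(rkhs_fun (f0 - f) x).
  by apply: le_lt_trans f0fx _; have := normr_ge0 (f0 - f); lra.
pose g x : R^o := lim ((fun f : rkhs Kpsd => rkhs_fun f x : R) @ F).
(* The bound [legendre (f0 - f) v <= e ^+ 2] involves finitely many values of f,
   so it passes to the pointwise limit g. *)
have legendre_lim (f0 : rkhs Kpsd) e : 0 <= e ->
    (\forall f \near F, `|f0 - f| <= e) -> forall v,
    legendre K (rkhs_fun f0 - g) v <= e ^+ 2.
  move=> e0 f0F v.
  have : legendre K (rkhs_fun f0 - rkhs_fun f) v @[f --> F] -->
      legendre K (rkhs_fun f0 - g) v.
    apply: cvgB; last exact: cvg_cst.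
    apply: cvgM; first exact: cvg_cst.
    apply: lcomb_cvg => x; apply: cvgB; first exact: cvg_cst.
    exact: eval_cvg.
  move/cvgr_to_le; apply; near=> f.
  have : `|f0 - f| <= e by near: f.
  rewrite -(@ler_pXn2r _ 2)// ?nnegrE// sqr_sqrtr; last exact: rkhsQ_ge0.
  apply: le_trans; exact: (legendre_le v (rkhsP (f0 - f))).
have gH : g \in rkhs_pred.
  have [f0 f0F] := Fclose 1 ltr01.
  apply/asboolP; rewrite -(subKr (rkhs_fun f0) g); apply: in_rkhsB => //.
    exact: rkhsP.
  by exists (1 ^+ 2); apply: legendre_lim.
apply/cvg_ex; exists (Rkhs Kpsd gH).
apply/cvgrPdist_le => e e0.
have e20 : 0 < e / 2 by rewrite divr_gt0.
have [f0 f0F] := Fclose _ e20.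
near=> f.
have f0f : `|f0 - f| <= e / 2 by near: f.
have f0g : `|f0 - Rkhs Kpsd gH| <= e / 2.
  rewrite -(ger0_norm (ltW e20)) -sqrtr_sqr; apply: ler_wsqrtr.
  by apply: dualQ_le; apply: legendre_lim => //; exact: ltW.
rewrite (splitr e) (le_trans (ler_distD f0 _ _))// lerD//.
by rewrite distrC.
Unshelve. all: by end_near. Qed.

HB.instance Definition _ :=
  Uniform_isComplete.Build (rkhs Kpsd) rkhs_cauchy_cvg.

Definition rkhs_dot : rkhs Kpsd -> rkhs Kpsd -> R := polar rkhsQ.

Lemma rkhs_dot_bilinear : bilinear_for
  (GRing.Scale.Law.clone _ _ ( *%R ) _) (GRing.Scale.Law.clone _ _ ( *%R ) _)
  rkhs_dot.
Proof.
have dotC := polarC rkhsQZ.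
have dotD := polarDl rkhsQZ rkhsQ_parallelogram.
have dotZ := polarZl rkhsQ_ge0 rkhsQZ rkhsQ_parallelogram.
by split=> u c v w; rewrite /rkhs_dot ?(dotC u) dotD dotZ// !(dotC u).
Qed.

HB.instance Definition _ := @bilinear_isBilinear.Build R _ _ _ _ _ rkhs_dot
  rkhs_dot_bilinear.

Lemma rkhs_dot_hermitian u v :
  rkhs_dot u v = (-1) ^+ false * idfun (rkhs_dot v u).
Proof. by rewrite expr0 mul1r; exact: (polarC rkhsQZ). Qed.

HB.instance Definition _ := @isHermitianSesquilinear.Build R (rkhs Kpsd) false
  idfun rkhs_dot rkhs_dot_hermitian.

Lemma rkhs_dot_gt0 u : u != 0 -> 0 < rkhs_dot u u.
Proof.
rewrite /rkhs_dot (polarxx rkhsQZ) lt0r rkhsQ_ge0 andbT.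
by apply: contra => /eqP/rkhsQ_eq0 ->.
Qed.

HB.instance Definition _ :=
  @isDotProduct.Build R (rkhs Kpsd) rkhs_dot rkhs_dot_gt0.

Lemma rkhs_is_hilbert : is_hilbert (rkhs Kpsd).
Proof.
exists rkhs_dot => u; rewrite [RHS](polarxx rkhsQZ) sqr_sqrtr//.
exact: rkhsQ_ge0.
Qed.

End rkhs.

(** * Spaces of negative type *)

Section negative_type.
Context {R : realType}.
Implicit Types (A : metricType R).

Lemma similarity_mx_sym A (B : {fset A}) : similarity_mx B \is symmetricmx.
Proof.
apply/is_hermitianmxP; rewrite expr0 scale1r.
by apply/matrixP => i j; rewrite !mxE /= metric_sym.
Qed.

Lemma positive_definite_semidefinite A :
  positive_definite A -> positive_semidefinite A.
Proof.
move=> Apd B /Apd[Bsym Bpd]; split=> // v.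
have [->|/Bpd/ltW//] := eqVneq v 0.
by rewrite !mul0mx mxE.
Qed.

Lemma semidefinite_bform A : positive_semidefinite A ->
  forall w : seq (R * A), 0 <= bform (fun x y => expR (- mdist x y)) w w.
Proof.
by move=> Apsd; apply: semidefinite_mx_bform => B v /Apsd[_]; apply.
Qed.

(** Since 1 + s <= exp s, the quotient lies between d / (1 + t d) and d. *)
Lemma one_minus_expR_over_cvg (t : nat -> {posnum R}) (d : R) :
  (t k)%:num @[k --> \oo] --> (0 : R) -> 0 <= d ->
  (t k)%:num^-1 * (1 - expR (- ((t k)%:num * d))) @[k --> \oo] --> d.
Proof.
move=> t0 d0.
apply: (@squeeze_cvgr _ _ _ _ (fun k => d / (1 + (t k)%:num * d)) (fun=> d)).
- apply: nearW => k; have tk : 0 < (t k)%:num by [].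
  have tkd : 0 <= (t k)%:num * d by rewrite mulr_ge0// ltW.
  have D0 : 0 < 1 + (t k)%:num * d by rewrite ltr_wpDr.
  apply/andP; split; last first.
    rewrite mulrC ler_pdivrMr//; have := expR_ge1Dx (- ((t k)%:num * d)); lra.
  have -> : d / (1 + (t k)%:num * d) =
      (t k)%:num^-1 * (1 - (1 + (t k)%:num * d)^-1).
    by field; rewrite !gt_eqF.
  rewrite ler_pM2l ?invr_gt0// lerD2l lerN2 expRN.
  rewrite lef_pV2 ?posrE ?expR_gt0//.
  exact: expR_ge1Dx.
- rewrite -[X in _ --> X]divr1; apply: cvgM; first exact: cvg_cst.
  apply: cvgV; first exact: oner_neq0.
  rewrite -[X in _ --> X]addr0 -[X in _ --> _ + X](mul0r d).
  by apply: cvgD; [exact: cvg_cst|apply: cvgM => //; exact: cvg_cst].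
- exact: cvg_cst.
Qed.

Lemma half_snowflake_dist A (x y : snowflake half_itv01 A) :
  mdist x y = Num.sqrt (mdist (x : A) (y : A)).
Proof. by rewrite -powR12_sqrt ?mdist_ge0. Qed.

Definition conditionally_negative A :=
  forall w : seq (R * A), lcomb w (fun=> 1) = 0 -> bform mdist w w <= 0.

Lemma semidefinite_conditionally_negative A (t : nat -> {posnum R}) :
  (t k)%:num @[k --> \oo] --> (0 : R) ->
  (forall k, positive_semidefinite (scaled (t k) A)) ->
  conditionally_negative A.
Proof.
move=> t0 tpsd w w0.
pose D k (x y : A) := (t k)%:num^-1 * (1 - expR (- ((t k)%:num * mdist x y))).
have Dcvg : bform (D k) w w @[k --> \oo] --> bform mdist w w.
  apply: lcomb_cvg => x; apply: lcomb_cvg => y.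
  by apply: one_minus_expR_over_cvg => //; exact: mdist_ge0.
apply: (cvgr_to_le Dcvg); apply: nearW => k.
have -> : bform (D k) w w = - ((t k)%:num^-1 *
    bform (fun x y : scaled (t k) A => expR (- mdist x y)) w w).
  rewrite /bform.
  under eq_lcomb do rewrite lcombZ lcombD w0 lcombN add0r.
  by rewrite lcombZ lcombN mulrN.
by rewrite oppr_le0 mulr_ge0// (semidefinite_bform (tpsd k)).
Qed.

(** The inner product of x and y, with origin a, when d is a squared
distance. *)
Definition based_kernel A (a x y : A) : R :=
  (mdist x a + mdist y a - mdist x y) / 2.

Lemma based_kernel_dist A (a x y : A) :
  based_kernel a x x + based_kernel a y y - 2 * based_kernel a x y = mdist x y.
Proof. by rewrite /based_kernel !mdistxx; field. Qed.

(** With c the total mass of w, the combination w - c a has mass 0, and its form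
for d is -2 times the form of the kernel at w. *)
Lemma based_kernel_psd A (a : A) :
  conditionally_negative A -> psd_kernel (based_kernel a).
Proof.
move=> Acn; split=> [x y|w].
  by rewrite /based_kernel (metric_sym x y) (addrC (mdist x a)).
pose c := lcomb w (fun=> 1); pose s := lcomb w (mdist^~ a).
pose w' := (- c, a) :: w.
have w'E f : lcomb w' f = - c * f a + lcomb w f by rewrite /lcomb big_cons.
have w'0 : lcomb w' (fun=> 1) = 0 by rewrite w'E mulr1 addNr.
have -> : bform (based_kernel a) w w = - (bform mdist w' w' / 2).
  have -> : bform mdist w' w' = bform mdist w w - 2 * c * s.
    have sE : lcomb w (mdist a) = s by apply: eq_lcomb => x; exact: metric_sym.
    rewrite /bform w'E w'E mdistxx sE mulr0 add0r.
    under eq_lcomb do rewrite w'E.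
    by rewrite lcombD lcombZ -/s; ring.
  have -> : bform (based_kernel a) w w = (c * s + c * s - bform mdist w w) / 2.
    rewrite /bform /based_kernel.
    under eq_lcomb => x.
      rewrite lcombMr lcombD lcombN lcombD.
      have -> : lcomb w (fun=> mdist x a) = c * mdist x a.
        by rewrite -lcombMr; apply: eq_lcomb => y; rewrite mul1r.
      over.
    rewrite lcombMr lcombD lcombN lcombD lcombZ -/s.
    have -> : lcomb w (fun=> s) = c * s.
      by rewrite -lcombMr; apply: eq_lcomb => y; rewrite mul1r.
    by [].
  by field.
by rewrite oppr_ge0 ler_pdivrMr// mul0r Acn.
Qed.

Lemma conditionally_negative_negative_type A :
  [set: A] !=set0 -> conditionally_negative A -> negative_type A.
Proof.
move=> [a _] Acn; have Kpsd := based_kernel_psd a Acn.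
exists (rkhs Kpsd); first exact: rkhs_is_hilbert.
have section_rkhs x : kernel_section (based_kernel a) [:: (1, x)] \in
    rkhs_pred (based_kernel a).
  by apply/asboolP; exact: kernel_section_in_rkhs.
exists (fun x : A => Rkhs Kpsd (section_rkhs x)) => x y.
rewrite half_snowflake_dist -[LHS]/(Num.sqrt (dualQ (based_kernel a) _)).
congr Num.sqrt.
pose u : seq (R * A) := [:: (1, x); (-1, y)].
have -> : rkhs_fun (Rkhs Kpsd (section_rkhs x) - Rkhs Kpsd (section_rkhs y)) =
    kernel_section (based_kernel a) u.
  apply/funext => z.
  rewrite -[LHS]/(kernel_section _ _ z - kernel_section _ _ z).
  by rewrite /kernel_section /lcomb /= !big_cons !big_nil /=; ring.
rewrite dualQ_kernel_section// -(based_kernel_dist a).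
rewrite /bform /lcomb !big_cons !big_nil /=.
rewrite (Kpsd.1 y x); ring.
Qed.

Lemma negative_type_kernel A : negative_type A ->
  exists2 K : A -> A -> R, psd_kernel K &
    forall x y, mdist x y = K x x + K y y - 2 * K x y.
Proof.
move=> [H [dot dotE] [f fE]].
have dotC u v : dot u v = dot v u.
  by have := hermC dot u v; rewrite expr0 mul1r.
exists (fun x y => dot (f x) (f y)) => [|x y].
  split=> [x y|w]; first exact: dotC.
  pose h := \sum_(p <- w) p.1 *: f p.2.
  have -> : bform (fun x y => dot (f x) (f y)) w w = dot h h.
    rewrite /bform /lcomb /h linear_sumlz; apply: eq_bigr => p _.
    rewrite linearZl_LR /=; congr (_ * _).
    rewrite linear_sumr /=; apply: eq_bigr => q _.
    by rewrite linearZr_LR.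
  by rewrite -dotE sqr_ge0.
have /(congr1 (fun z => z ^+ 2)) := fE x y.
rewrite /= dotE half_snowflake_dist sqr_sqrtr ?mdist_ge0// => <-.
rewrite linearBl !linearBr /= -(dotC (f x) (f y)); ring.
Qed.

(** As exp(- d) = exp(- c K(x, x)) exp(- c K(y, y)) exp(2 c K(x, y)), the first
two factors are absorbed into the weights. *)
Lemma kernel_dist_positive_definite A (K : A -> A -> R) (c : R) :
  psd_kernel K -> 0 < c ->
  (forall x y : A, mdist x y = c * (K x x + K y y - 2 * K x y)) ->
  positive_definite A.
Proof.
move=> Kpsd c0 KE B B0.
split=> [|v v0]; first exact: similarity_mx_sym.
rewrite (bform_mx (fun x y : A => expR (- mdist x y))) /=.
set w := map _ _.
pose h (x : A) := expR (- (c * K x x)).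
pose w' := [seq (p.1 * h p.2, p.2) | p <- w].
have -> : bform (fun x y : A => expR (- mdist x y)) w w =
    bform (fun x y => expR (2 * c * K x y)) w' w'.
  rewrite /bform lcomb_map; apply: eq_lcomb => x.
  rewrite lcomb_map -lcombZ; apply: eq_lcomb => y.
  by rewrite KE /h -!expRD; congr expR; ring.
apply: exp_kernel_strict => //; first by rewrite mulr_gt0.
- by move=> x y xy; rewrite -subr_gt0 -(pmulr_rgt0 _ c0) -KE mdist_gt0.
- rewrite /w' /w -!map_comp map_inj_uniq ?index_enum_uniq// => i j /= /val_inj.
  exact: enum_val_inj.
- have [i vi] : exists i, v 0 i != 0 by apply/rV0Pn.
  apply/hasP; exists (v 0 i * h (val (enum_val i)), val (enum_val i)).
    apply/mapP; exists (v 0 i, val (enum_val i)) => //.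
    by apply/mapP; exists i => //; rewrite mem_index_enum.
  by rewrite mulf_neq0//= gt_eqF ?expR_gt0.
Qed.

Lemma negative_type_positive_definite A :
  negative_type A -> positive_definite A.
Proof.
move=> /negative_type_kernel[K Kpsd KE].
apply: (kernel_dist_positive_definite Kpsd ltr01) => x y.
by rewrite KE mul1r.
Qed.

Lemma negative_type_stably_positive_definite A :
  negative_type A -> stably_positive_definite A.
Proof.
move=> /negative_type_kernel[K Kpsd KE] t.
apply: (@kernel_dist_positive_definite (scaled t A) K t%:num) => // x y.
by rewrite -KE.
Qed.

End negative_type.

(** * Magnitude of compact subspaces *)

Section dirac_magnitude.
Context {R : realType}.

(** A negative set of a measure is null, so in every Hahn decomposition the
negative part is 0 and the positive part is the measure itself. *)
Lemma charge_integral_finite_measure d (T : measurableType d)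
    (mu : {finite_measure set T -> \bar R}) (f : T -> R) :
  charge_integral (charge_of_finite_measure mu) f = \int[mu]_x f x.
Proof.
rewrite /charge_integral.
set muPN := projT2 (cid (projT2 (cid (Hahn_decomposition _)))).
move: muPN; set P := projT1 _; set N := projT1 _ => muPN.
have [_ [mN negN] _ _] := muPN.
have muN0 A : measurable A -> mu (A `&` N) = 0%E.
  move=> mA; apply/eqP; rewrite eq_le measure_ge0 andbT.
  by apply: negN; [exact: measurableI|exact: subIsetr].
have neg0 A : measurable A -> jordan_neg muPN A = 0%E.
  move=> mA; rewrite jordan_negE cjordan_negE /crestr0 mem_set// /crestr.
  by rewrite [X in (- X)%E]muN0// oppe0.
have posE A : measurable A -> jordan_pos muPN A = mu A.
  move=> mA; rewrite -[RHS]/(charge_of_finite_measure mu A).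
  rewrite (jordan_decomp muPN mA) /cadd /= cscaleN1.
  by rewrite [X in (_ - X)%E](neg0 _ mA) oppe0 adde0.
rewrite /Rintegral.
rewrite (@eq_measure_integral _ _ _ _ mu (jordan_pos muPN)); last first.
  by move=> A mA _; exact: posE.
rewrite (@eq_measure_integral _ _ _ _ mzero (jordan_neg muPN)); last first.
  by move=> A mA _; exact: neg0.
by rewrite integral_measure_zero subr0.
Qed.

Lemma mdist_continuous (T : metricType R) (x : T) :
  continuous (fun y => mdist x y : R).
Proof.
move=> y; apply/cvgrPdist_lt => e e0; near=> z.
have yz : mdist y z < e.
  have : ball y e z by near: z; exact: nbhsx_ballx.
  by rewrite ballEmdist.
have := metric_triangle x y z; have := metric_triangle x z y.
rewrite (metric_sym z y) ltr_norml => ? ?; apply/andP; split; lra.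
Unshelve. all: by end_near. Qed.

Lemma measurable_similarity (K : metricType R) (K0 : [set: K] !=set0) (x : K) :
  measurable_fun [set: borel K0] (fun y : borel K0 => expR (- mdist x (y : K))).
Proof.
apply: (measurability _ (measurable_realfun.RGenOInfty.measurableE R)) => //.
move=> _ [_ [r ->] <-].
rewrite setTI; apply: sub_sigma_algebra.
apply: open_comp; last exact: rray_open.
move=> y _; apply: continuous_comp; last exact: continuous_expR.
by apply: continuousN; exact: mdist_continuous.
Qed.

Lemma magnitude_ge1 (K : metricType R) (K0 : [set: K] !=set0) :
  (1%:E <= magnitude K0)%E.
Proof.
pose a : borel K0 := point.
pose mu :=
  charge_of_finite_measure (dirac a : {finite_measure set _ -> \bar R}).
have diracE (f : borel K0 -> R) : measurable_fun setT f ->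
    charge_integral mu f = f a.
  move=> mf; rewrite charge_integral_finite_measure /Rintegral integral_dirac//.
    by rewrite diracT mul1e.
  exact/measurable_realfun.measurable_EFinP.
have form1 : similarity_form mu mu = 1.
  rewrite /similarity_form.
  under eq_fun => x do
    rewrite (diracE _ (@measurable_similarity K K0 x)) metric_sym.
  by rewrite (diracE _ (@measurable_similarity K K0 a)) mdistxx oppr0 expR0.
apply: ereal_sup_ubound; exists mu; first by rewrite /= form1 oner_neq0.
rewrite form1 divr1 -[X in fine X]/(\d_a [set: borel K0]) diracT.
by rewrite expr1n.
Qed.

End dirac_magnitude.

Section compact_subspaces.
Context {R : realType}.
Implicit Types (A : metricType R).

Lemma compact_set_type A (K : set A) : compact K -> compact [set: set_type K].
Proof.
move=> cK F FF _.
have [|p [Kp clp]] := cK (set_val @ F).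
  by apply: (filterE (F := F)) => x; exact: set_valP.
pose q : set_type K := exist _ p (mem_set Kp).
exists q; split=> // B U FB /nbhs_ballP[e e0 qU].
have [||z [[x Bx xz] pz]] := clp (set_val @` B) (ball p e).
- change (F (set_val @^-1` (set_val @` B))).
  by apply: filterS FB => x Bx; exists x.
- exact: nbhsx_ballx.
- exists x; split=> //; apply: qU.
  by move: pz; rewrite -xz !ballEmdist.
Qed.

Lemma negative_type_set_type A (K : set A) :
  negative_type A -> negative_type (set_type K).
Proof.
move=> [H Hh [f fE]]; exists H => //.
by exists (fun x : set_type K => f (set_val x)) => x y; rewrite fE.
Qed.

Lemma negative_type_has_magnitude A (K : set A) : negative_type A ->
  compact K -> K !=set0 ->
  exists2 m : \bar R, has_magnitude (set_type K) m & (1%:E <= m)%E.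
Proof.
move=> Ant cK [x Kx].
have K0 : [set: set_type K] !=set0 by exists (exist _ x (mem_set Kx)).
exists (magnitude K0); last exact: magnitude_ge1.
split; [exact: compact_set_type| |by exists K0].
exact/negative_type_positive_definite/negative_type_set_type.
Qed.

End compact_subspaces.

Theorem theorem3p3 (R : realType) (A : metricType R) (A0 : [set: A] !=set0) :
  [<-> stably_positive_definite A;
       stably_positive_semidefinite A;
       exists2 t : nat -> {posnum R}, (t k)%:num @[k --> \oo] --> (0 : R) &
         forall k, positive_semidefinite (scaled (t k) A);
       negative_type A] /\
  (stably_positive_definite A ->
   forall K : set A, compact K -> K !=set0 ->
     exists2 m : \bar R, has_magnitude (set_type K) m & (1%:E <= m)%E).
Proof.
have spd_spsd : stably_positive_definite A -> stably_positive_semidefinite A.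
  by move=> Apd t; exact: positive_definite_semidefinite.
have spsd_seq : stably_positive_semidefinite A ->
    exists2 t : nat -> {posnum R}, (t k)%:num @[k --> \oo] --> (0 : R) &
      forall k, positive_semidefinite (scaled (t k) A).
  move=> Apsd; exists (fun k => (k.+1%:R^-1)%:pos); first exact: cvg_harmonic.
  by move=> k; exact: Apsd.
have seq_nt : (exists2 t : nat -> {posnum R},
    (t k)%:num @[k --> \oo] --> (0 : R) &
    forall k, positive_semidefinite (scaled (t k) A)) -> negative_type A.
  move=> [t t0 tpsd]; apply: conditionally_negative_negative_type => //.
  exact: (semidefinite_conditionally_negative t0).
split=> [|Apd K].
  2: exact/negative_type_has_magnitude/seq_nt/spsd_seq/spd_spsd.
by tfae => //; exact: negative_type_stably_positive_definite.
Qed.
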